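(* Let $\mathcal{A}\in\mathbb{R}^{I_1\times\cdots\times I_D}$ be a tensor given by a tensor train (TT) in site-$1$-mixed-canonical form, and let $\epsilon$ be a prescribed upper bound on the relative error. If the TT-to-truncated-HOSVD algorithm described in the context is run with the tolerance of each of its $D$ truncated SVDs set to $\delta=\epsilon\|\mathcal{A}\|_F/\sqrt{D}$, then the computed Tucker approximation $\mathcal{B}=\mathcal{S}\times_1\mathbf{U}_1\times_2\cdots\times_D\mathbf{U}_D$ satisfies $$\|\mathcal{A}-\mathcal{B}\|_F\le\epsilon\,\|\mathcal{A}\|_F .$$
   Context: All tensors are real; $\|\cdot\|_F^2$ is the sum of squares of all entries. Multi-indices are linearized with the first index running fastest: $[i_1i_2\cdots i_D]=i_1+\sum_{k=2}^D(i_k-1)\prod_{l=1}^{k-1}I_l$; ''reshape'' keeps this linear order and ''permute'' reorders the indices. The $d$-mode product $\mathcal{A}\times_d\mathbf{U}$ of $\mathcal{A}$ with $\mathbf{U}\in\mathbb{R}^{J\times I_d}$ has entries $\sum_{i_d}\mathcal{A}(i_1,\ldots,i_d,\ldots,i_D)\,\mathbf{U}(j,i_d)$ (index $j$ in position $d$). A TT of $\mathcal{A}$ is a set of cores $\mathcal{A}^{(d)}\in\mathbb{R}^{R_d\times I_d\times R_{d+1}}$, $1\le d\le D$, with $R_1=R_{D+1}=1$, such that $\mathcal{A}(i_1,\ldots,i_D)=\sum_{r_1,\ldots,r_D}\mathcal{A}^{(1)}(r_1,i_1,r_2)\cdots\mathcal{A}^{(D)}(r_D,i_D,r_1)$. A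 core is left-orthogonal if its reshaping to an $R_dI_d\times R_{d+1}$ matrix has orthonormal columns, and right-orthogonal if its reshaping to an $R_d\times I_dR_{d+1}$ matrix has orthonormal rows. The TT is in site-$d$-mixed-canonical form if cores $1,\ldots,d-1$ are left-orthogonal and cores $d+1,\ldots,D$ are right-orthogonal. Algorithm (TT to truncated HOSVD). Input: a TT of $\mathcal{A}$ in site-$1$-mixed-canonical form and a tolerance $\delta$. For $d=1,\ldots,D$: (1) Let $\mathbf{A}_d$ be the $I_d\times(R_dR_{d+1})$ matrix obtained from the current core $\mathcal{A}^{(d)}$ with entries $\mathbf{A}_d(i_d,[r_dr_{d+1}])=\mathcal{A}^{(d)}(r_d,i_d,r_{d+1})$. Compute a truncated SVD $\mathbf{A}_d=\mathbf{U}_d\mathbf{S}\mathbf{V}^T+\mathbf{E}$, retaining the $S_d\geq1$ largest singular values, with $\|\mathbf{E}\|_F\le\delta$; here $\mathbf{U}_d\in\mathbb{R}^{I_d\times S_d}$ has orthonormal columns. (2) Let $\mathcal{T}\in\mathbb{R}^{R_d\times S_d\times R_{d+1}}$ be $\mathbf{S}\mathbf{V}^T$ reshaped to $S_d\times R_d\times R_{d+1}$ with its first two indices swapped. (3) If $d=D$, set $\mathcal{S}^{(D)}=\mathcal{T}$. Otherwise reshape $\mathcal{T}$ to an $R_dS_d\times R_{d+1}$ matrix, compute its thin QR decomposition $\mathbf{Q}\mathbf{R}$ ($\mathbf{Q}$ with orthonormal columns), let $\mathcal{S}^{(d)}$ be $\mathbf{Q}$ reshaped to a 3-way core with first two dimensions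 $R_d,S_d$, and replace $\mathcal{A}^{(d+1)}$ by $\mathcal{A}^{(d+1)}\times_1\mathbf{R}$. (If $R_dS_d<R_{d+1}$, then $\mathbf{Q}$ has $R_dS_d$ columns and $R_{d+1}$ is replaced by $R_dS_d$ from then on.) Output: factor matrices $\mathbf{U}_1,\ldots,\mathbf{U}_D$ and the Tucker core $\mathcal{S}\in\mathbb{R}^{S_1\times\cdots\times S_D}$ whose TT-cores are $\mathcal{S}^{(1)},\ldots,\mathcal{S}^{(D)}$. *)

(* Defs.v *)
From HB Require Import structures.
From mathcomp Require Import all_boot all_order all_algebra.

Set Implicit Arguments.
Unset Strict Implicit.
Unset Printing Implicit Defensive.

Import Order.TTheory GRing.Theory Num.Theory.
Local Open Scope ring_scope.

(* Everything is stated over an arbitrary real closed field, which includes   *)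
(* the field of real numbers.  Modes are numbered from 0 to D - 1, and the    *)
(* families indexed by a mode (dimensions, ranks, cores, factor matrices) are *)
(* indexed by nat: for a D-way tensor only dimensions, cores and factors with *)
(* index d < D and ranks with index d <= D are ever used.                     *)

Definition mindex (D : nat) (N : nat -> nat) :=
  {dffun forall d : 'I_D, 'I_(N d)}.

Definition tensor (R : rcfType) (D : nat) (N : nat -> nat) :=
  {ffun mindex D N -> R}.

Definition tensor_norm (R : rcfType) (D : nat) (N : nat -> nat)
    (X : tensor R D N) : R :=
  Num.sqrt (\sum_i X i ^+ 2).

Definition mx_norm (R : rcfType) (m n : nat) (M : 'M[R]_(m, n)) : R :=
  Num.sqrt (\sum_i \sum_j M i j ^+ 2).

(* The d-mode product of X with M.  The dimensions of the result are N'; they *)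
(* are meant to coincide with N at every mode other than d, so that j ranges  *)
(* over the indices obtained from i by changing its d-th component only.      *)
Definition mode_mul (R : rcfType) (D : nat) (N N' : nat -> nat) (d : 'I_D)
    (M : 'M[R]_(N' d, N d)) (X : tensor R D N) : tensor R D N' :=
  [ffun i : mindex D N' =>
     \sum_(j : mindex D N |
            [forall k : 'I_D, (k != d) ==> (j k == i k :> nat)])
        X j * M (i d) (j d)].

(* Dimensions of an Sd-tensor whose first k modes have been multiplied by     *)
(* matrices with row dimensions N.                                            *)
Definition mixdim (N Sd : nat -> nat) (k d : nat) : nat :=
  if (d < k)%N then N d else Sd d.

Lemma mixdim_lt (N Sd : nat -> nat) (k d : nat) :
  (d < k)%N -> N d = mixdim N Sd k d.
Proof. by rewrite /mixdim => ->. Qed.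

Lemma mixdim_ge (N Sd : nat -> nat) (k d : nat) :
  (k <= d)%N -> Sd d = mixdim N Sd k d.
Proof. by rewrite /mixdim ltnNge => ->. Qed.

(* X x_1 U_1 x_2 ... x_k U_k *)
Fixpoint mode_muls (R : rcfType) (D : nat) (N Sd : nat -> nat)
    (U : forall d : nat, 'M[R]_(N d, Sd d)) (X : tensor R D Sd) (k : nat) :
    (k <= D)%N -> tensor R D (mixdim N Sd k) :=
  match k return (k <= D)%N -> tensor R D (mixdim N Sd k) with
  | 0 => fun _ => X
  | k'.+1 => fun lt_k'D =>
      @mode_mul R D (mixdim N Sd k') (mixdim N Sd k'.+1) (Ordinal lt_k'D)
        (castmx (mixdim_lt N Sd (ltnSn k'), mixdim_ge N Sd (leqnn k')) (U k'))
        (mode_muls U X (ltnW lt_k'D))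
  end.

(* X x_1 U_1 x_2 ... x_D U_D, seen as a tensor with dimensions N *)
Definition tucker (R : rcfType) (D : nat) (N Sd : nat -> nat)
    (X : tensor R D Sd) (U : forall d : nat, 'M[R]_(N d, Sd d)) :
    tensor R D N :=
  [ffun i : mindex D N =>
     mode_muls U X (leqnn D)
       [ffun d : 'I_D => cast_ord (mixdim_lt N Sd (ltn_ord d)) (i d)]].

(* Linearization of a pair of indices, the first one running fastest. *)
Lemma lin_subproof (m n : nat) (a : 'I_m) (b : 'I_n) : (a + b * m < m * n)%N.
Proof.
apply: (@leq_trans (b.+1 * m)); first by rewrite mulSn ltn_add2r.
by rewrite [(m * n)%N]mulnC leq_mul2r ltn_ord orbT.
Qed.

Definition lin (m n : nat) (a : 'I_m) (b : 'I_n) : 'I_(m * n) :=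
  Ordinal (lin_subproof a b).

Lemma lin_fst_subproof (m n : nat) (k : 'I_(m * n)) : (k %% m < m)%N.
Proof. by case: m k => [|m] k; [case: k | rewrite ltn_pmod]. Qed.

Lemma lin_snd_subproof (m n : nat) (k : 'I_(m * n)) : (k %/ m < n)%N.
Proof.
by case: m k => [|m] k; [case: k | rewrite ltn_divLR // [(n * _)%N]mulnC].
Qed.

Definition lin_fst (m n : nat) (k : 'I_(m * n)) : 'I_m :=
  Ordinal (lin_fst_subproof k).
Definition lin_snd (m n : nat) (k : 'I_(m * n)) : 'I_n :=
  Ordinal (lin_snd_subproof k).

Definition core (R : rcfType) (a n b : nat) := {ffun 'I_a * 'I_n * 'I_b -> R}.

(* (a n) x b *)
Definition left_unfold (R : rcfType) (a n b : nat) (X : core R a n b) :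
    'M[R]_(a * n, b) :=
  \matrix_(k, q) X (lin_fst k, lin_snd k, q).

(* a x (n b) *)
Definition right_unfold (R : rcfType) (a n b : nat) (X : core R a n b) :
    'M[R]_(a, n * b) :=
  \matrix_(p, k) X (p, lin_fst k, lin_snd k).

(* n x (a b) *)
Definition mid_unfold (R : rcfType) (a n b : nat) (X : core R a n b) :
    'M[R]_(n, a * b) :=
  \matrix_(i, k) X (lin_fst k, i, lin_snd k).

Definition left_fold (R : rcfType) (a n b : nat) (M : 'M[R]_(a * n, b)) :
    core R a n b :=
  [ffun t => M (lin t.1.1 t.1.2) t.2].

Definition mid_fold (R : rcfType) (a n b : nat) (M : 'M[R]_(n, a * b)) :
    core R a n b :=
  [ffun t => M t.1.2 (lin t.1.1 t.2)].

(* The 1-mode product of a core with a matrix. *)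
Definition core_mul1 (R : rcfType) (a a' n b : nat) (M : 'M[R]_(a', a))
    (X : core R a n b) : core R a' n b :=
  [ffun t => \sum_(p < a) X (p, t.1.2, t.2) * M t.1.1 p].

Definition castcore (R : rcfType) (a a' n b b' : nat)
    (ea : a = a') (eb : b = b') (X : core R a n b) : core R a' n b' :=
  [ffun t => X (cast_ord (esym ea) t.1.1, t.1.2, cast_ord (esym eb) t.2)].

Definition left_orthogonal (R : rcfType) (a n b : nat) (X : core R a n b) :=
  (left_unfold X)^T *m left_unfold X = 1%:M.

Definition right_orthogonal (R : rcfType) (a n b : nat) (X : core R a n b) :=
  right_unfold X *m (right_unfold X)^T = 1%:M.

(* The sum over the rank indices p_0, ..., p_D of the products                *)
(* X_0(p_0, i_0, p_1) ... X_(D-1)(p_(D-1), i_(D-1), p_D).  When r 0 = r D = 1 *)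
(* (see is_tt), p_0 and p_D both take a single value.                         *)
Definition tt_tensor (R : rcfType) (D : nat) (N r : nat -> nat)
    (X : forall d : nat, core R (r d) (N d) (r d.+1)) : tensor R D N :=
  [ffun i : mindex D N =>
     \sum_(p : mindex D.+1 r)
       \prod_(d < D) X d (p (widen_ord (leqnSn D) d), i d, p (lift ord0 d))].

Definition is_tt (R : rcfType) (D : nat) (N r : nat -> nat)
    (X : forall d : nat, core R (r d) (N d) (r d.+1)) (A : tensor R D N) :=
  [/\ r 0 = 1%N, r D = 1%N & A = tt_tensor D X].

(* Site-s-mixed-canonical form, sites being numbered from 0. *)
Definition mixed_canonical (R : rcfType) (D : nat) (N r : nat -> nat) (s : nat)
    (X : forall d : nat, core R (r d) (N d) (r d.+1)) :=
  (forall d : nat, (d < s)%N -> left_orthogonal (X d)) /\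
  (forall d : nat, (s < d < D)%N -> right_orthogonal (X d)).

(* Thin singular value decomposition M = U diag(s) V^T, with the minn m n     *)
(* singular values in nonincreasing order.                                    *)
Definition is_svd (R : rcfType) (m n : nat) (M : 'M[R]_(m, n))
    (U : 'M[R]_(m, minn m n)) (s : 'rV[R]_(minn m n))
    (V : 'M[R]_(n, minn m n)) :=
  [/\ U^T *m U = 1%:M,
      V^T *m V = 1%:M,
      forall i, 0 <= s 0 i,
      forall i j : 'I_(minn m n), (i <= j)%N -> s 0 j <= s 0 i
    & M = U *m diag_mx s *m V^T].

(* U, s, V hold the leading k singular triples of some SVD of M, and the      *)
(* truncation error is at most delta in the Frobenius norm.                   *)
Definition truncated_svd (R : rcfType) (m n k : nat) (delta : R)
    (M : 'M[R]_(m, n)) (U : 'M[R]_(m, k)) (s : 'rV[R]_k) (V : 'M[R]_(n, k)) :=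
  (exists Uf sf Vf, is_svd M Uf sf Vf /\
     exists le_k : (k <= minn m n)%N,
       [/\ U = colsub (widen_ord le_k) Uf,
           s = colsub (widen_ord le_k) sf
         & V = colsub (widen_ord le_k) Vf]) /\
  mx_norm (M - U *m diag_mx s *m V^T) <= delta.

Definition thin_qr (R : rcfType) (m n k : nat) (M : 'M[R]_(m, n))
    (Q : 'M[R]_(m, k)) (T : 'M[R]_(k, n)) :=
  [/\ k = minn m n,
      Q^T *m Q = 1%:M,
      forall (i : 'I_k) (j : 'I_n), (j < i)%N -> T i j = 0
    & M = Q *m T].

(* There is a run of the algorithm on the TT-cores X (ranks r), with tolerance *)
(* delta, that outputs the factor matrices U and the TT-cores G of the Tucker *)
(* core.  Sd gives the dimensions of the Tucker core and q its TT-ranks.      *)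
(* C d is the core number d when the loop reaches it: its left rank is then   *)
(* the updated one, q d, while its right rank is still r d.+1.  T d is the    *)
(* core obtained from the truncated SVD of C d, and Rf d is the triangular    *)
(* factor of the QR decomposition of T d.  The equalities r 0 = q 0 and       *)
(* r D = q D express that the two outer ranks never change.                   *)
Definition tt_to_thosvd (R : rcfType) (D : nat) (N r Sd q : nat -> nat)
    (delta : R)
    (X : forall d : nat, core R (r d) (N d) (r d.+1))
    (U : forall d : nat, 'M[R]_(N d, Sd d))
    (G : forall d : nat, core R (q d) (Sd d) (q d.+1)) :=
  exists (C : forall d : nat, core R (q d) (N d) (r d.+1))
         (T : forall d : nat, core R (q d) (Sd d) (r d.+1))
         (Rf : forall d : nat, 'M[R]_(q d.+1, r d.+1)),
  [/\ exists e0 : r 0 = q 0, C 0 = castcore e0 erefl (X 0),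
      forall d : nat, (d < D)%N ->
        (0 < Sd d)%N /\
        exists (s : 'rV[R]_(Sd d)) (V : 'M[R]_(q d * r d.+1, Sd d)),
          truncated_svd delta (mid_unfold (C d)) (U d) s V /\
          T d = mid_fold (diag_mx s *m V^T),
      forall d : nat, (d.+1 < D)%N ->
        exists Q : 'M[R]_(q d * Sd d, q d.+1),
          [/\ thin_qr (left_unfold (T d)) Q (Rf d),
              G d = left_fold Q
            & C d.+1 = core_mul1 (Rf d) (X d.+1)]
    & forall d : nat, d.+1 = D ->
        exists eD : r d.+1 = q d.+1, G d = castcore erefl eD (T d)].

(* Main.v *)
Require Import Defs.
From mathcomp Require Import all_boot all_order all_algebra.
Import Order.TTheory GRing.Theory Num.Theory.
Local Open Scope ring_scope.
Set Implicit Arguments.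
Unset Strict Implicit.
Unset Printing Implicit Defensive.

(* Let x_k(i_k, ..., i_(D-1)) be the product of the slices of the input cores *)
(* k, ..., D-1, y_k the corresponding product for the cores Y_d of the output *)
(* tensor (the cores of the Tucker core with U_d applied to their middle      *)
(* index), and z_k = C_k x_(k+1) - y_k, so that z_0 is the total error.       *)
(* Splitting the core C_k met by the algorithm at step k into its truncation  *)
(* and the remainder E_k gives z_k = E_k x_(k+1) + Y_k z_(k+1).  As U_k^T E_k *)
(* vanishes, the two terms are orthogonal; since x_(k+1) is right-orthogonal  *)
(* and Y_k left-orthogonal, their squared norms are those of E_k and z_(k+1). *)
(* Hence the squared error is the sum of the |E_k|^2, at most D * delta^2.    *)

(** Both tensors are trains: multilinearity absorbs the factors [U] into the Tucker cores
    ([tucker_tt_tensor]), so the error is a difference of two products of slices. The canonical form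
    makes the tail of the input train right-orthogonal ([ttv_right_orthogonal]); the QR factors
    together with the orthonormal columns of [U d] make every output core but the last
    left-orthogonal ([sum_mul_orthonormal]); an SVD residual is orthogonal to the retained columns
    ([truncated_svd_orthogonal]). Hence truncation errors add in squares: [pythagoras] does one site
    and [sum_nrm2_truncation] iterates it. The choice of [delta] turns the total into the square of
    [eps * tensor_norm A]. *)

Definition icons_fun (D : nat) (N : nat -> nat) (a : 'I_(N 0%N))
    (j : mindex D (fun d => N d.+1)) (d : 'I_D.+1) : 'I_(N d) :=
  match d return 'I_(N d) with
  | Ordinal m lt_m =>
    match m return (m < D.+1)%N -> 'I_(N m) with
    | 0 => fun _ => a
    | k.+1 => fun lt_k => j (@Ordinal D k lt_k)
    end lt_m
  end.

(** Matching on the value of [d] in [icons_fun] lets [N d] reduce to [N 0] or [N k.+1], so no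
    transport between dimensions is needed. *)
Definition icons (D : nat) (N : nat -> nat) (a : 'I_(N 0%N))
    (j : mindex D (fun d => N d.+1)) : mindex D.+1 N :=
  [ffun d => icons_fun a j d].

Definition itail (D : nat) (N : nat -> nat) (i : mindex D.+1 N) :
    mindex D (fun d => N d.+1) :=
  [ffun d => i (lift ord0 d)].

Lemma icons0 D N (a : 'I_(N 0%N)) (j : mindex D (fun d => N d.+1)) :
  icons a j ord0 = a.
Proof. by rewrite ffunE. Qed.

Lemma icons_lift D N (a : 'I_(N 0%N)) (j : mindex D (fun d => N d.+1)) d :
  icons a j (lift ord0 d) = j d.
Proof.
rewrite ffunE /icons_fun /=; case: d => m lt_m /=.
by congr (j (Ordinal _)); apply: bool_irrelevance.
Qed.

Lemma icons_widen_lift D N (a : 'I_(N 0%N)) (j : mindex D.+1 (fun d => N d.+1))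
    (d : 'I_D) :
  icons a j (widen_ord (leqnSn D.+1) (lift ord0 d)) =
  j (widen_ord (leqnSn D) d).
Proof.
rewrite ffunE /icons_fun /=; case: d => m lt_m /=.
by congr (j (Ordinal _)); apply: bool_irrelevance.
Qed.

Lemma itail_icons D N (a : 'I_(N 0%N)) (j : mindex D (fun d => N d.+1)) :
  itail (icons a j) = j.
Proof. by apply/ffunP => d; rewrite ffunE icons_lift. Qed.

Lemma icons_itail D N (i : mindex D.+1 N) : icons (i ord0) (itail i) = i.
Proof.
apply/ffunP => -[[|m] lt_m]; rewrite ffunE /icons_fun /=.
  by congr (i (Ordinal _)); apply: bool_irrelevance.
by rewrite ffunE; congr (i (Ordinal _)); apply: bool_irrelevance.
Qed.

Lemma sum_icons (V : nmodType) D N (F : mindex D.+1 N -> V) :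
  \sum_i F i =
  \sum_(a : 'I_(N 0%N)) \sum_(j : mindex D (fun d => N d.+1)) F (icons a j).
Proof.
rewrite pair_bigA /=.
rewrite (reindex (fun aj : 'I_(N 0%N) * mindex D (fun d => N d.+1) =>
  icons aj.1 aj.2)) //=.
exists (fun i : mindex D.+1 N => (i ord0, itail i)) => [[a j] _ | i _] /=.
  by rewrite icons0 itail_icons.
by rewrite icons_itail.
Qed.

Lemma sum_mindex0 (V : nmodType) N (F : mindex 0 N -> V) (i0 : mindex 0 N) :
  \sum_i F i = F i0.
Proof.
rewrite (big_pred1 i0) // => i; apply/esym/eqP/ffunP.
by case.
Qed.

Definition inil N : mindex 0 N :=
  [ffun d : 'I_0 => match d with Ordinal m lt => False_rect _ (notF lt) end].

(** Distributivity over dependent indices. Since [g d] acts on natural numbers, the same weights can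
    be used with dimensions that are equal only propositionally. *)
Lemma sum_prod_mindex (R : comNzRingType) D N (g : 'I_D -> nat -> R) :
  \sum_(i : mindex D N) \prod_(d < D) g d (i d) =
  \prod_(d < D) \sum_(a < N d) g d a.
Proof.
elim: D N g => [|D IH] N g.
  by rewrite (sum_mindex0 _ (inil N)) !big_ord0.
rewrite sum_icons big_ord_recl mulr_suml; apply: eq_bigr => a _.
rewrite -(IH (fun d => N d.+1) (fun d => g (lift ord0 d))) mulr_sumr.
apply: eq_bigr => j _; rewrite big_ord_recl icons0; congr (_ * _).
by apply: eq_bigr => d _; rewrite icons_lift.
Qed.

(** * Tensor trains as products of slices *)

Section Train.
Variable R : rcfType.

Definition core_slice a n b (X : core R a n b) (i : 'I_n) : 'M[R]_(a, b) :=
  \matrix_(p, t) X (p, i, t).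

Definition slices (N r : nat -> nat)
    (X : forall d : nat, core R (r d) (N d) (r d.+1)) d (a : 'I_(N d)) :
    'M[R]_(r d, r d.+1) :=
  core_slice (X d) a.

(* The product of the slices X d (i d) applied to the all-ones vector.  As    *)
(* r D = 1 in a TT, this vector is the scalar 1; it avoids casts along r D.   *)
Fixpoint ttv (D : nat) : forall (N r : nat -> nat)
    (X : forall d, 'I_(N d) -> 'M[R]_(r d, r d.+1)),
    mindex D N -> 'cV[R]_(r 0%N) :=
  match D return forall (N r : nat -> nat)
    (X : forall d, 'I_(N d) -> 'M[R]_(r d, r d.+1)),
    mindex D N -> 'cV[R]_(r 0%N) with
  | 0 => fun N r X i => const_mx 1
  | D'.+1 => fun N r X i =>
      X 0%N (i ord0) *m
      @ttv D' (fun d => N d.+1) (fun d => r d.+1) (fun d => X d.+1) (itail i)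
  end.

(** Expanding the matrix product gives the sums over the inner ranks; the outer sum over [a] and the
    all-ones vector inside [ttv] account for the first and last rank indices. *)
Lemma tt_tensorE D N r (X : forall d : nat, core R (r d) (N d) (r d.+1)) i :
  tt_tensor D X i = \sum_a ttv (slices X) i a 0.
Proof.
rewrite ffunE sum_icons; apply: eq_bigr => a _.
elim: D N r X i a => [|D IH] N r X i a.
  by rewrite (sum_mindex0 _ (inil _)) big_ord0 mxE.
rewrite sum_icons mxE; apply: eq_bigr => b _; rewrite mxE.
rewrite -(IH _ _ (fun d => X d.+1)) mulr_sumr.
apply: eq_bigr => j _; rewrite big_ord_recl; congr (_ * _).
  by rewrite icons_lift icons0; congr (X 0%N (_, _, _)); rewrite ffunE.
apply: eq_bigr => d _.
have eqX (p p' : 'I_(r d.+1)) (a1 a2 : 'I_(N d.+1)) (t t' : 'I_(r d.+2)) :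
  p = p' -> a1 = a2 -> t = t' -> X d.+1 (p, a1, t) = X d.+1 (p', a2, t').
  by move=> -> -> ->.
apply: eqX; [exact: icons_widen_lift | by rewrite ffunE |].
exact: (@icons_lift D.+1 r a (icons (N := fun d => r d.+1) b j) (lift ord0 d)).
Qed.


(** * Entries of a Tucker product, and its form as a train *)

(* The entries of a matrix as a function of natural numbers, 0 out of range:  *)
(* it is invariant under castmx.                                              *)
Definition nmx m n (M : 'M[R]_(m, n)) (a b : nat) : R :=
  if insub a is Some i then if insub b is Some j then M i j else 0 else 0.

Lemma nmxE m n (M : 'M[R]_(m, n)) (i : 'I_m) (j : 'I_n) : nmx M i j = M i j.
Proof. by rewrite /nmx !valK. Qed.

Lemma nmx_cast m n m' n' (e : (m = m') * (n = n')) (M : 'M[R]_(m, n)) :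
  nmx (castmx e M) = nmx M.
Proof.
by case: e => em en; case: m' / em; case: n' / en; rewrite castmx_id.
Qed.

Lemma sum_ord_delta n (c : nat) (f : nat -> R) :
  (c < n)%N -> \sum_(a < n) (a == c :> nat)%:R * f a = f c.
Proof.
move=> lt_cn; rewrite (bigD1 (Ordinal lt_cn)) //= eqxx mul1r big1 ?addr0 //.
by move=> a; rewrite -val_eqE /= => /negPf ->; rewrite mul0r.
Qed.

Section Tucker.
Variables (D : nat) (N Sd : nat -> nat).
Variable U : forall d : nat, 'M[R]_(N d, Sd d).

(* Weight of mode d after k mode products: the modes from k on are untouched. *)
Definition wgt (k d a b : nat) : R :=
  if (d < k)%N then nmx (U d) a b else (a == b)%:R.

(** Modes not yet multiplied carry Kronecker deltas, so that every stage has the same product form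
    and the induction on [k] changes only one weight. *)
Lemma mode_mulsE (X : tensor R D Sd) k (le_kD : (k <= D)%N)
    (i : mindex D (mixdim N Sd k)) :
  mode_muls U X le_kD i =
  \sum_(j : mindex D Sd) X j * \prod_(d < D) wgt k d (i d) (j d).
Proof.
elim: k le_kD i => [|k IH] lt_kD i.
  rewrite (bigD1 (i : mindex D Sd)) //= [X in _ * X]big1 ?mulr1; last first.
    by move=> d _; rewrite /wgt eqxx.
  rewrite big1 ?addr0 // => j /eqP neq_ji.
  case: (pickP (fun d => i d != j d :> nat)) => [d /negPf neq_d | eq_ij].
    by rewrite (bigD1 d) //= /wgt neq_d mul0r mulr0.
  case: neq_ji; apply/ffunP => d; apply/val_inj.
  by have /negbFE/eqP eq_d := eq_ij d; exact/esym/eq_d.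
rewrite [LHS]ffunE; set kD := Ordinal lt_kD.
under eq_bigr => l _ do rewrite -nmxE nmx_cast IH mulr_suml.
rewrite exchange_big /=; apply: eq_bigr => j _.
under eq_bigr => l _ do rewrite -mulrA.
rewrite -mulr_sumr; congr (_ * _).
(* The constraint that [l] agrees with [i] off mode [k] becomes a product of Kronecker factors, so
   the sum over [l] factors mode by mode. At mode [k] the old weight is itself a delta, which
   selects the entry of [U k]. *)
pose g (d : 'I_D) (a : nat) : R :=
  (if d == kD then nmx (U k) (i kD) a else (a == i d :> nat)%:R)
  * wgt k d a (j d).
transitivity (\sum_(l : mindex D (mixdim N Sd k)) \prod_(d < D) g d (l d)).
  rewrite big_mkcond; apply: eq_bigr => l _; rewrite big_split /= mulrC.
  case: ifP => [/forallP eq_li | /negbT/forallPn[d]]; last first.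
    rewrite negb_imply => /andP[/negPf neq_d /negPf neq_li].
    by rewrite (bigD1 d) //= neq_d neq_li !mul0r.
  congr (_ * _); rewrite (bigD1 kD) //= eqxx big1 ?mulr1 // => d neq_d.
  by rewrite (negPf neq_d) (eqP (implyP (eq_li d) neq_d)) eqxx.
rewrite sum_prod_mindex; apply: eq_bigr => d _; rewrite /g.
case: eqP => [-> | /eqP neq_d].
  under eq_bigr => a _ do rewrite /wgt ltnn mulrC.
  by rewrite sum_ord_delta /wgt ?ltnSn //= /mixdim ltnn.
have neq_dk : (d == k :> nat) = false by apply/negbTE; exact: neq_d.
have eq_lt : (d < k.+1)%N = (d < k)%N by rewrite ltnS leq_eqVlt neq_dk.
rewrite (sum_ord_delta (fun a => wgt k d a (j d))) /wgt ?eq_lt //.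
have <- : mixdim N Sd k.+1 d = mixdim N Sd k d by rewrite /mixdim eq_lt.
exact: ltn_ord.
Qed.

Lemma tuckerE (X : tensor R D Sd) i :
  tucker X U i = \sum_j X j * \prod_(d < D) U d (i d) (j d).
Proof.
rewrite ffunE mode_mulsE; apply: eq_bigr => j _; congr (_ * _).
by apply: eq_bigr => d _; rewrite /wgt ltn_ord ffunE /= nmxE.
Qed.

End Tucker.

Definition mode2_mul N Sd q (U : forall d, 'M[R]_(N d, Sd d))
    (G : forall d, 'I_(Sd d) -> 'M[R]_(q d, q d.+1)) d (a : 'I_(N d)) :
    'M[R]_(q d, q d.+1) :=
  \sum_s U d a s *: G d s.

(** By multilinearity of the train in its cores, each factor can be pushed into the core of its own
    mode. *)
Lemma ttv_mode2_mul D N Sd q (U : forall d, 'M[R]_(N d, Sd d))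
    (G : forall d, 'I_(Sd d) -> 'M[R]_(q d, q d.+1)) (i : mindex D N) :
  \sum_(j : mindex D Sd) (\prod_(d < D) U d (i d) (j d)) *: ttv G j =
  ttv (mode2_mul U G) i.
Proof.
elim: D N Sd q U G i => [|D IH] N Sd q U G i.
  by rewrite (sum_mindex0 _ (inil _)) big_ord0 scale1r.
rewrite sum_icons /= /mode2_mul mulmx_suml; apply: eq_bigr => s _.
rewrite -(IH _ _ _ (fun d => U d.+1) (fun d => G d.+1)) mulmx_sumr.
apply: eq_bigr => j _; rewrite icons0 itail_icons big_ord_recl icons0.
rewrite -scalemxAl -scalemxAr scalerA; congr (_ * _ *: _).
by apply: eq_bigr => d _; rewrite icons_lift ffunE.
Qed.

Lemma tucker_tt_tensor D N Sd q (U : forall d, 'M[R]_(N d, Sd d))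
    (G : forall d : nat, core R (q d) (Sd d) (q d.+1)) i :
  tucker (tt_tensor D G) U i = \sum_a ttv (mode2_mul U (slices G)) i a 0.
Proof.
rewrite tuckerE -ttv_mode2_mul.
under [RHS]eq_bigr => a _ do rewrite summxE.
rewrite exchange_big; apply: eq_bigr => j _ /=.
by rewrite tt_tensorE mulr_suml; apply: eq_bigr => a _; rewrite mxE mulrC.
Qed.

(** * Squared Frobenius norms and the error recursion *)

(** The trace form makes cyclicity available for the orthogonality arguments. *)
Definition nrm2 m n (M : 'M[R]_(m, n)) : R := \tr (M^T *m M).

Lemma nrm2E m n (M : 'M[R]_(m, n)) : nrm2 M = \sum_i \sum_j M i j ^+ 2.
Proof.
rewrite /nrm2 /mxtrace exchange_big; apply: eq_bigr => j _ /=; rewrite mxE.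
by apply: eq_bigr => i _; rewrite mxE expr2.
Qed.

Lemma mul_const_mx1_tr n :
  n = 1%N -> const_mx 1 *m (const_mx 1 : 'cV_n)^T = 1%:M :> 'M[R]_n.
Proof.
by move=> ->; apply/matrixP => a b; rewrite !ord1 !mxE big_ord1 !mxE mulr1.
Qed.

(** The sum telescopes from the right: the tail contributes the identity, leaving the relation for
    the first core. The base case needs [r D = 1]. *)
Lemma ttv_right_orthogonal D N r
    (X : forall d, 'I_(N d) -> 'M[R]_(r d, r d.+1)) :
    r D = 1%N ->
    (forall d, (d < D)%N -> \sum_a X d a *m (X d a)^T = 1%:M) ->
  \sum_(i : mindex D N) ttv X i *m (ttv X i)^T = 1%:M.
Proof.
elim: D N r X => [|D IH] N r X r1 orthX.
  by rewrite (sum_mindex0 _ (inil _)) /= mul_const_mx1_tr.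
rewrite sum_icons /= -(orthX 0%N) //; apply: eq_bigr => a _.
under eq_bigr => j _ do rewrite icons0 itail_icons trmx_mul -mulmxA
  [ttv _ _ *m (_ *m _)]mulmxA.
rewrite -mulmx_sumr -mulmx_suml IH ?mul1mx //.
by move=> d lt_d; apply: (orthX d.+1).
Qed.

(** The sums over [a] and [j] are independent: summing the cross terms over [a] gives 0, while in
    the square terms [x] is removed by summing over [j] and [Y] by summing over [a]. *)
Lemma pythagoras (I J : finType) m n p l (E : I -> 'M[R]_(m, n))
    (Y : I -> 'M[R]_(m, p)) (x : J -> 'M[R]_(n, l)) (z : J -> 'M[R]_(p, l)) :
    \sum_a (Y a)^T *m Y a = 1%:M -> \sum_a (Y a)^T *m E a = 0 ->
    \sum_j x j *m (x j)^T = 1%:M ->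
  \sum_a \sum_j nrm2 (E a *m x j + Y a *m z j) =
  \sum_a nrm2 (E a) + \sum_j nrm2 (z j).
Proof.
move=> orthY orthYE orthx.
have orthEY : \sum_a (E a)^T *m Y a = 0.
  rewrite -[LHS]trmxK raddf_sum /=.
  under eq_bigr => a _ do rewrite trmx_mul trmxK.
  by rewrite orthYE trmx0.
have nrm2D a j : nrm2 (E a *m x j + Y a *m z j) =
  \tr ((E a)^T *m E a *m (x j *m (x j)^T)) +
  (\tr ((z j)^T *m ((Y a)^T *m E a) *m x j) +
   \tr ((x j)^T *m ((E a)^T *m Y a) *m z j)) +
  \tr ((z j)^T *m ((Y a)^T *m Y a) *m z j).
  rewrite /nrm2 [(_ + _)^T]linearD /= mulmxDl !mulmxDr !mxtraceD.
  rewrite !trmx_mul !mulmxA.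
  (* Cyclicity brings [x j] next to its transpose. *)
  rewrite [\tr ((E a)^T *m _ *m _ *m _)]mxtrace_mulC !mulmxA.
  by rewrite -!addrA; congr (_ + _); rewrite addrCA.
under eq_bigr => a _ do under eq_bigr => j _ do rewrite nrm2D.
under eq_bigr => a _ do rewrite !big_split /=.
rewrite !big_split /=; congr (_ + _).
  rewrite [X in _ + (X + _)]exchange_big [X in _ + (_ + X)]exchange_big /=.
  rewrite [X in _ + (X + _)]big1 ?[X in _ + (_ + X)]big1 ?addr0.
  - apply: eq_bigr => a _.
    by rewrite -raddf_sum -mulmx_sumr orthx mulmx1.
  - move=> j _; rewrite -raddf_sum -mulmx_suml -mulmx_sumr orthEY.
    by rewrite mulmx0 mul0mx raddf0.
  - move=> j _; rewrite -raddf_sum -mulmx_suml -mulmx_sumr orthYE.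
    by rewrite mulmx0 mul0mx raddf0.
rewrite exchange_big; apply: eq_bigr => j _ /=.
by rewrite -raddf_sum -mulmx_suml -mulmx_sumr orthY mulmx1.
Qed.

(** The QR relation [Y *m Rf = C'] lets the retained part share the left factor [Y] with the output;
    [Rf *m X] is then the next core met by the algorithm. *)
Lemma truncation_split m n p k l (C C' : 'M[R]_(m, n)) (Y : 'M_(m, p))
    (Rf : 'M_(p, n)) (X : 'M_(n, k)) (v : 'M_(k, l)) (w : 'M_(p, l)) :
    Y *m Rf = C' ->
  C *m (X *m v) - Y *m w =
  (C - C') *m (X *m v) + Y *m (Rf *m X *m v - w).
Proof. by move=> <-; rewrite mulmxBl mulmxBr !mulmxA addrA subrK. Qed.

(** Here [C'] is the truncation of [C], and [D] is the last site, where no QR is done. There [Y] and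
    [C'] have right ranks that need not be convertible, so they are compared only through the
    all-ones vector. *)
Lemma sum_nrm2_truncation D N r q
    (X : forall d, 'I_(N d) -> 'M[R]_(r d, r d.+1))
    (C C' : forall d, 'I_(N d) -> 'M[R]_(q d, r d.+1))
    (Y : forall d, 'I_(N d) -> 'M[R]_(q d, q d.+1))
    (Rf : forall d, 'M[R]_(q d.+1, r d.+1)) (e : R) :
    r D.+1 = 1%N ->
    (forall d, (d < D)%N -> \sum_a X d.+1 a *m (X d.+1 a)^T = 1%:M) ->
    (forall d a, (d < D)%N -> C d.+1 a = Rf d *m X d.+1 a) ->
    (forall d, (d < D)%N -> \sum_a (Y d a)^T *m Y d a = 1%:M) ->
    (forall d, (d < D)%N -> \sum_a (Y d a)^T *m (C d a - C' d a) = 0) ->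
    (forall d a, (d < D)%N -> Y d a *m Rf d = C' d a) ->
    (forall a, Y D a *m const_mx 1 = C' D a *m const_mx 1 :> 'cV_(q D)) ->
    (forall d, (d <= D)%N -> \sum_a nrm2 (C d a - C' d a) <= e) ->
  \sum_(i : mindex D.+1 N)
     nrm2 (C 0%N (i ord0) *m ttv (fun d => X d.+1) (itail i) - ttv Y i)
  <= e *+ D.+1.
Proof.
elim: D N r q X C C' Y Rf => [|D IH] N r q X C C' Y Rf r1 orthX defC orthY
  orthYE defC' lastY err.
  (* With one site left, the remaining tail is the all-ones vector of size [r 1 = 1], which
     preserves the norm. *)
  rewrite sum_icons (le_trans _ (err 0%N _)) //; apply: ler_sum => a _.
  rewrite (sum_mindex0 _ (inil _)) icons0 /= icons0 lastY -mulmxBl.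
  rewrite /nrm2 mxtrace_mulC trmx_mul mulmxA -[_ *m _ *m (const_mx 1)^T]mulmxA.
  by rewrite mul_const_mx1_tr // mulmx1 mxtrace_mulC.
rewrite sum_icons.
pose x (j : mindex D.+1 (fun d => N d.+1)) := ttv (fun d => X d.+1) j.
pose z (j : mindex D.+1 (fun d => N d.+1)) :=
  C 1%N (j ord0) *m ttv (fun d => X d.+2) (itail j) - ttv (fun d => Y d.+1) j.
have split_err a j : C 0%N a *m x j - Y 0%N a *m ttv (fun d => Y d.+1) j =
    (C 0%N a - C' 0%N a) *m x j + Y 0%N a *m z j.
  by rewrite /z defC //; apply: truncation_split; apply: defC'.
under eq_bigr => a _.
  under eq_bigr => j _ do rewrite icons0 /= icons0 itail_icons split_err.
  over.
rewrite pythagoras ?orthY ?orthYE //; last first.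
  by apply: ttv_right_orthogonal => // d lt_d; apply: (orthX d).
rewrite mulrS lerD ?err //.
apply: (IH _ _ _ (fun d => X d.+1) (fun d => C d.+1) (fun d => C' d.+1)
  (fun d => Y d.+1) (fun d => Rf d.+1)) => //.
- by move=> d lt_d; apply: (orthX d.+1).
- by move=> d a lt_d; apply: (defC d.+1).
- by move=> d lt_d; apply: (orthY d.+1).
- by move=> d lt_d; apply: (orthYE d.+1).
- by move=> d a lt_d; apply: (defC' d.+1).
- by move=> d lt_d; apply: (err d.+1).
Qed.

(** * Unfoldings, slices and the truncated SVD *)

Lemma lin_fst_lin m n (a : 'I_m) (b : 'I_n) : lin_fst (lin a b) = a.
Proof. by apply/val_inj; rewrite /= addnC modnMDl modn_small. Qed.

Lemma lin_snd_lin m n (a : 'I_m) (b : 'I_n) : lin_snd (lin a b) = b.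
Proof.
have m_gt0 : (0 < m)%N by case: m a => [[]|].
by apply/val_inj; rewrite /= addnC divnMDl // divn_small ?addn0.
Qed.

Lemma lin_split m n (k : 'I_(m * n)) : lin (lin_fst k) (lin_snd k) = k.
Proof. by apply/val_inj; rewrite /= addnC -divn_eq. Qed.

Lemma sum_lin (V : nmodType) m n (F : 'I_(m * n) -> V) :
  \sum_k F k = \sum_a \sum_b F (lin a b).
Proof.
rewrite pair_bigA /= (reindex (fun ab : 'I_m * 'I_n => lin ab.1 ab.2)) //=.
exists (fun k => (lin_fst k, lin_snd k)) => [[a b] _ | k _] /=.
  by rewrite lin_fst_lin lin_snd_lin.
exact: lin_split.
Qed.

Lemma colsub_orthonormal m n k (w : 'I_k -> 'I_n) (M : 'M[R]_(m, n)) :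
    injective w -> M^T *m M = 1%:M ->
  (colsub w M)^T *m colsub w M = 1%:M.
Proof.
move=> inj_w orthM; apply/matrixP => i j.
transitivity ((M^T *m M) (w i) (w j)).
  by rewrite !mxE; apply: eq_bigr => l _; rewrite !mxE.
by rewrite orthM !mxE (inj_eq inj_w).
Qed.

(** The columns of [U] are among the orthonormal columns of the full SVD, so [U^T *m M] is exactly
    the retained block [diag_mx s *m V^T], and [U^T] annihilates the residual. *)
Lemma truncated_svd_orthogonal m n k delta (M : 'M[R]_(m, n)) (U : 'M_(m, k))
    s (V : 'M_(n, k)) :
    truncated_svd delta M U s V ->
  [/\ U^T *m U = 1%:M, U^T *m (M - U *m (diag_mx s *m V^T)) = 0
    & nrm2 (M - U *m (diag_mx s *m V^T)) <= delta ^+ 2].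
Proof.
case=> -[Uf [sf [Vf [[orthU _ _ _ defM] [le_k [defU defs defV]]]]]].
have inj_w : injective (widen_ord le_k).
  by move=> a b /(congr1 val) /= /val_inj.
have orthU1 : U^T *m U = 1%:M by rewrite defU colsub_orthonormal.
rewrite -mulmxA => le_delta; split=> //.
  rewrite mulmxBr [U^T *m (U *m _)]mulmxA orthU1 mul1mx; apply/eqP.
  rewrite subr_eq0; apply/eqP.
  have -> : U^T *m M = rowsub (widen_ord le_k) (diag_mx sf *m Vf^T).
    rewrite -[diag_mx sf *m _]mul1mx -orthU -mulmxA [Uf *m _]mulmxA -defM.
    by rewrite -mul_rowsub_mx defU trmx_mxsub.
  by apply/matrixP => i j; rewrite defs defV !mul_diag_mx !mxE.
have nrm2_ge0 : 0 <= \sum_i \sum_j (M - U *m (diag_mx s *m V^T)) i j ^+ 2.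
  by apply: sumr_ge0 => i _; apply: sumr_ge0 => j _; apply: sqr_ge0.
rewrite nrm2E -(sqr_sqrtr nrm2_ge0) ler_sqr // nnegrE ?sqrtr_ge0 //.
exact: le_trans (sqrtr_ge0 _) le_delta.
Qed.

Lemma sum_core_slice_tr a n b (X : core R a n b) :
  \sum_i (core_slice X i)^T *m core_slice X i =
  (left_unfold X)^T *m left_unfold X.
Proof.
apply/matrixP => t u; rewrite summxE !mxE sum_lin exchange_big.
apply: eq_bigr => i _ /=; rewrite !mxE; apply: eq_bigr => p _.
by rewrite !mxE lin_fst_lin lin_snd_lin.
Qed.

Lemma sum_core_slice_mul_tr a n b (X : core R a n b) :
  \sum_i core_slice X i *m (core_slice X i)^T =
  right_unfold X *m (right_unfold X)^T.
Proof.
apply/matrixP => p p'; rewrite summxE !mxE sum_lin.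
apply: eq_bigr => i _ /=; rewrite !mxE; apply: eq_bigr => t _.
by rewrite !mxE lin_fst_lin lin_snd_lin.
Qed.

Lemma core_slice_mul1 a a' n b (M : 'M_(a', a)) (X : core R a n b) i :
  core_slice (core_mul1 M X) i = M *m core_slice X i.
Proof.
apply/matrixP => p t; rewrite !mxE ffunE /=; apply: eq_bigr => l _.
by rewrite !mxE mulrC.
Qed.

Lemma left_foldK a n b (M : 'M[R]_(a * n, b)) : left_unfold (left_fold M) = M.
Proof. by apply/matrixP => k t; rewrite !mxE ffunE /= lin_split. Qed.

Lemma core_slice_left_fold_mul a n b c (Q : 'M[R]_(a * n, b)) (T : core R a n c)
    (Rf : 'M_(b, c)) i :
  left_unfold T = Q *m Rf ->
  core_slice (left_fold Q) i *m Rf = core_slice T i.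
Proof.
move=> defT; apply/matrixP => p t.
have := congr1 (fun M : 'M_(_, _) => M (lin p i) t) defT.
rewrite !mxE lin_fst_lin lin_snd_lin => ->.
by apply: eq_bigr => l _; rewrite !mxE ffunE.
Qed.

Lemma sum_core_slice_mid_fold m a n b (U : 'M[R]_(m, n)) (K : 'M_(n, a * b)) i :
  \sum_s U i s *: core_slice (mid_fold K) s =
  \matrix_(p, t) (U *m K) i (lin p t).
Proof.
apply/matrixP => p t; rewrite summxE !mxE; apply: eq_bigr => s _.
by rewrite !mxE ffunE.
Qed.

Lemma core_slice_mid a n b (X : core R a n b) i :
  core_slice X i = \matrix_(p, t) mid_unfold X i (lin p t).
Proof. by apply/matrixP => p t; rewrite !mxE lin_fst_lin lin_snd_lin. Qed.

(** The all-ones vector does not see a cast of the right rank; this handles the last core. *)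
Lemma castcore_mul_const a n b b' c (eb : b = b') (X : core R a n b) i (x : R) :
  core_slice (castcore erefl eb X) i *m (const_mx x : 'M_(b', c)) =
  core_slice X i *m const_mx x.
Proof.
case: b' / eb; congr (_ *m _); apply/matrixP => p t.
by rewrite !mxE ffunE /= !cast_ord_id.
Qed.

Lemma sum_castcore_mul a a' n b (ea : a = a') (X : core R a n b) i
    (v : 'cV_b) :
  \sum_p (core_slice (castcore ea erefl X) i *m v) p 0 =
  \sum_p (core_slice X i *m v) p 0.
Proof.
case: a' / ea; apply: eq_bigr => p _; congr ((_ *m v) p 0).
by apply/matrixP => p' t; rewrite !mxE ffunE /= !cast_ord_id.
Qed.

(** Orthonormal columns of [U] turn the double sum over [s] and [u] into its diagonal; thus a
    left-orthogonal core stays so after its middle index is multiplied by [U]. *)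
Lemma sum_mul_orthonormal m n a b (U : 'M[R]_(m, n)) (G : 'I_n -> 'M_(a, b)) :
    U^T *m U = 1%:M ->
  \sum_i (\sum_s U i s *: G s)^T *m (\sum_s U i s *: G s) =
  \sum_s (G s)^T *m G s.
Proof.
move=> orthU.
have -> : \sum_s (G s)^T *m G s =
    \sum_s \sum_u (U^T *m U) s u *: ((G s)^T *m G u).
  apply: eq_bigr => s _; rewrite orthU (bigD1 s) //= !mxE eqxx scale1r.
  by rewrite big1 ?addr0 // => u /negPf neq; rewrite mxE eq_sym neq scale0r.
under eq_bigr => i _.
  rewrite [(\sum_s _)^T]raddf_sum mulmx_suml /=.
  under eq_bigr => s _.
    rewrite mulmx_sumr /=.
    under eq_bigr => u _ do
      rewrite [(_ *: _)^T]linearZ /= -scalemxAl -scalemxAr scalerA.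
    over.
  over.
rewrite exchange_big; apply: eq_bigr => s _ /=.
rewrite exchange_big; apply: eq_bigr => u _ /=.
by rewrite -scaler_suml mxE; congr (_ *: _); apply: eq_bigr => i _; rewrite mxE.
Qed.

(** For each fixed [s], the sum over [i] is a row of [U^T *m E] reshaped, so it vanishes for any
    slices [G]. *)
Lemma sum_mul_orthogonal m n a b (U : 'M[R]_(m, n)) (G : 'I_n -> 'M_(a, b))
    c (E : 'M[R]_(m, a * c)) :
    U^T *m E = 0 ->
  \sum_i (\sum_s U i s *: G s)^T *m (\matrix_(p, t) E i (lin p t)) = 0.
Proof.
move=> orthE.
under eq_bigr => i _.
  rewrite [(\sum_s _)^T]raddf_sum mulmx_suml /=.
  under eq_bigr => s _ do rewrite [(_ *: _)^T]linearZ /= -scalemxAl scalemxAr.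
  over.
rewrite exchange_big big1 //= => s _; rewrite -mulmx_sumr.
suff -> : \sum_i U i s *: (\matrix_(p, t) E i (lin p t)) = 0 :> 'M_(a, c).
  by rewrite mulmx0.
apply/matrixP => p t; rewrite summxE.
have Us_E := congr1 (fun M : 'M_(_, _) => M s (lin p t)) orthE.
rewrite /= !mxE in Us_E; rewrite mxE -[RHS]Us_E; apply: eq_bigr => i _.
by rewrite !mxE.
Qed.

Lemma sum_nrm2_lin m a b (E : 'M[R]_(m, a * b)) :
  \sum_i nrm2 (\matrix_(p, t) E i (lin p t) : 'M_(a, b)) = nrm2 E.
Proof.
rewrite nrm2E; apply: eq_bigr => i _; rewrite sum_lin nrm2E.
by apply: eq_bigr => p _; apply: eq_bigr => t _; rewrite mxE.
Qed.

Lemma nrm2_cV1 n (v : 'cV[R]_n) : n = 1%N -> (\sum_a v a 0) ^+ 2 = nrm2 v.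
Proof. by move=> n1; subst n; rewrite nrm2E !big_ord1. Qed.

End Train.

(** * The error bound for a run of the algorithm *)

Theorem mainTheorem2 (R : rcfType) (D : nat) (N r Sd q : nat -> nat)
    (A : tensor R D N)
    (X : forall d : nat, core R (r d) (N d) (r d.+1))
    (eps : R)
    (U : forall d : nat, 'M[R]_(N d, Sd d))
    (G : forall d : nat, core R (q d) (Sd d) (q d.+1))
    (D_gt0 : (0 < D)%N)
    (ttA : is_tt X A)
    (canX : mixed_canonical D 0 X)
    (runX : tt_to_thosvd D (eps * tensor_norm A / Num.sqrt D%:R) X U G) :
  tensor_norm (A - tucker (tt_tensor D G) U) <= eps * tensor_norm A.
Proof.
case: D D_gt0 A ttA canX runX => // D _ A [r0 rD defA] [_ orthX].
set delta := _ / _; case=> [C [T [Rf [[e0 defC0] svdC qrT lastG]]]].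
(* The sign comes from the run: [delta] bounds the norm of the first residual. It is needed at the
   end to take the square root of a square. *)
have delta_ge0 : 0 <= delta.
  have [//|_ [s [V [[_ le_delta] _]]]] := svdC 0%N.
  exact: le_trans (sqrtr_ge0 _) le_delta.
have sqrtD_gt0 : 0 < Num.sqrt D.+1%:R :> R by rewrite sqrtr_gt0 ltr0n.
have epsA_ge0 : 0 <= eps * tensor_norm A.
  by rewrite -(mulfVK (lt0r_neq0 sqrtD_gt0) (eps * _)) mulr_ge0 // sqrtr_ge0.
pose Y := mode2_mul U (slices G).
pose C' d (a : 'I_(N d)) := \sum_s U d a s *: core_slice (T d) s.
(* [E] is the SVD residual of the unfolded core; its rows, reshaped, are the slice errors. *)
have defE d : (d < D.+1)%N -> exists E,
    [/\ (U d)^T *m U d = 1%:M, (U d)^T *m E = 0, nrm2 E <= delta ^+ 2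
      & forall a, core_slice (C d) a - C' d a = \matrix_(p, t) E a (lin p t)].
  move=> lt_dD; have [_ [s [V [/truncated_svd_orthogonal]]]] := svdC d lt_dD.
  move=> [orthU orthE leE] defT.
  exists (mid_unfold (C d) - U d *m (diag_mx s *m V^T)).
  split=> // a; rewrite /C' defT sum_core_slice_mid_fold core_slice_mid.
  by apply/matrixP => p t; rewrite !mxE.
pose Z (i : mindex D.+1 N) := core_slice (C 0%N) (i ord0)
  *m ttv (fun d => @slices R N r X d.+1) (itail i) - ttv Y i.
have le_err : \sum_i nrm2 (Z i) <= delta ^+ 2 *+ D.+1.
  apply: (@sum_nrm2_truncation _ D N r q (slices X)
    (fun d => core_slice (C d)) C' Y Rf).
  - exact: rD.
  - by move=> d lt_dD; rewrite sum_core_slice_mul_tr; apply: orthX.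
  - move=> d a lt_dD; have [Q [_ _ defC]] := qrT d lt_dD.
    by rewrite -core_slice_mul1 -defC.
  - move=> d lt_dD; have [|E [orthU _ _ _]] := defE d; first exact: ltnW.
    have [Q [[_ orthQ _ _] defG _]] := qrT d lt_dD.
    by rewrite sum_mul_orthonormal // sum_core_slice_tr defG left_foldK.
  - move=> d lt_dD; have [|E [_ orthE _ E_]] := defE d; first exact: ltnW.
    under eq_bigr => a _ do rewrite E_.
    exact: sum_mul_orthogonal.
  - move=> d a lt_dD; have [Q [[_ _ _ defT] defG _]] := qrT d lt_dD.
    rewrite mulmx_suml; apply: eq_bigr => s _; rewrite -scalemxAl.
    by rewrite -(core_slice_left_fold_mul _ defT) -defG.
  - move=> a; have [eD defG] := lastG D erefl.
    rewrite !mulmx_suml; apply: eq_bigr => s _; rewrite -!scalemxAl.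
    by congr (_ *: _); rewrite -(castcore_mul_const _ eD) -defG.
  - move=> d le_dD; have [|E [_ _ leE E_]] := defE d; first by [].
    by under eq_bigr => a _ do rewrite E_; rewrite sum_nrm2_lin.
(* As [q 0 = r 0 = 1], the vector [Z i] has a single entry, the error at [i]. *)
have Z2 i : (A - tucker (tt_tensor D.+1 G) U) i ^+ 2 = nrm2 (Z i).
  rewrite ffunE [in LHS]ffunE tucker_tt_tensor defA tt_tensorE /=.
  rewrite -(sum_castcore_mul e0) -defC0 -nrm2_cV1 -?e0 //; congr (_ ^+ 2).
  by rewrite -sumrB; apply: eq_bigr => a _; rewrite !mxE.
(* The square root in [delta] cancels the number of truncations, which is [D.+1] here. *)
have delta2 : delta ^+ 2 *+ D.+1 = (eps * tensor_norm A) ^+ 2.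
  rewrite -mulr_natr /delta expr_div_n sqr_sqrtr ?ler0n // divfK //.
  by rewrite pnatr_eq0.
rewrite -[leRHS]ger0_norm // -sqrtr_sqr -delta2.
rewrite /tensor_norm; apply: ler_wsqrtr.
by under eq_bigr => i _ do rewrite Z2.
Qed.
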